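(* Let $X$ be a compact metric space and let $f_n:X\to X$ be a continuous surjective map for each $n\ge0$. Then $(\mathcal{M}(X),\hat f_{0,\infty})$ is chain mixing, where $f_{0,\infty}=\{f_n\}_{n=0}^\infty$.
   Context: Let $(X,d)$ be a compact metric space. A non-autonomous dynamical system $(X,f_{0,\infty})$ is given by a sequence $f_{0,\infty}=\{f_n\}_{n=0}^\infty$ of continuous self-maps of $X$. $\mathcal{M}(X)$ is the space of all Borel probability measures on $X$ with the Prohorov metric $\mathcal{P}_d(\mu,\nu)=\inf\{\epsilon>0:\mu(A)\le\nu(A^\epsilon)+\epsilon \text{ and } \nu(A)\le\mu(A^\epsilon)+\epsilon \text{ for all Borel } A\subset X\}$, where $A^\epsilon=\{x\in X: d(x,A)<\epsilon\}$; its topology is the weak$^*$-topology and $\mathcal{M}(X)$ is a compact metric space. The induced system $(\mathcal{M}(X),\hat f_{0,\infty})$, $\hat f_{0,\infty}=\{\hat f_n\}_{n=0}^\infty$, consists of the continuous maps $\hat f_n(\mu)(A)=\mu(f_n^{-1}(A))$. For $\delta>0$, a $\delta$-chain from $x$ to $y$ with length $k\ge1$ is a finite sequence $x=x_0,x_1,\dots,x_k=y$ in $X$ with $d(f_n(x_n),x_{n+1})<\delta$ for $0\le n\le k-1$. $(X,f_{0,\infty})$ is chain mixing if for any $\varepsilon>0$ and any $x,y\in X$ there is $N\ge1$ such that for every $k\ge N$ there is an $\varepsilon$-chain from $x$ to $y$ with length $k$. For $\mathcal{M}(X)$ the metric used is $\mathcal{P}_d$. *)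

(* Defs.v *)
From HB Require Import structures.
From mathcomp Require Import all_boot all_order all_algebra.
From mathcomp Require Import all_classical all_reals all_analysis.

Set Implicit Arguments.
Unset Strict Implicit.
Unset Printing Implicit Defensive.

Import Order.TTheory GRing.Theory Num.Theory.
Import numFieldNormedType.Exports.

Local Open Scope classical_set_scope.
Local Open Scope ring_scope.

(* Measurable types, hence the library's probability measures, are pointed;
   the point only records that the metric space is nonempty. *)
#[short(type="pmetricType")]
HB.structure Definition PointedMetric (R : numDomainType) :=
  {T of Pointed T & Metric R T}.

(* The finite sequence is c 0, ..., c k; values of [c] beyond k are irrelevant. *)
Definition delta_chain (R : realType) (T : Type) (d : T -> T -> R)
    (f : nat -> T -> T) (delta : R) (x y : T) (k : nat) : Prop :=
  (1 <= k)%N /\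
  exists c : nat -> T, [/\ c 0%N = x, c k = y &
    forall n, (n < k)%N -> d (f n (c n)) (c n.+1) < delta].

Definition chain_mixing (R : realType) (T : Type) (d : T -> T -> R)
    (f : nat -> T -> T) : Prop :=
  forall eps : R, 0 < eps -> forall x y : T,
    exists N : nat, (1 <= N)%N /\
      forall k : nat, (N <= k)%N -> delta_chain d f eps x y k.

Section borel_probability.
Context (R : realType) (X : pmetricType R).

Definition borel : measurableType (@open X).-sigma :=
  g_sigma_algebraType (@open X).

Definition borel_probability : Type := probability borel R.

(* [edist_inf A x] is the extended-real distance from x to A; it is +oo when
   A is empty, so the neighborhood of the empty set is empty. *)
Definition nbhd (A : set X) (eps : R) : set X :=
  [set x | (edist_inf A x < eps%:E)%E].

Definition prohorov (mu nu : borel_probability) : R :=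
  inf [set eps : R | 0 < eps /\
    forall A : set borel, measurable A ->
      (mu A <= nu (nbhd A eps) + eps%:E)%E /\
      (nu A <= mu (nbhd A eps) + eps%:E)%E].

Lemma edist_mdist (x y : X) : edist (x, y) = (mdist x y)%:E.
Proof.
apply/eqP; rewrite eq_le; apply/andP; split.
  apply/lee_addgt0Pr => e e0; apply: ereal_inf_lbound.
  exists (mdist x y + e); last by rewrite EFinD.
  by split; [rewrite ltr_wpDl// mdist_ge0|rewrite ballEmdist /= ltrDl].
apply: le_ereal_inf_tmp => _ [r [_ +] <-].
by rewrite ballEmdist /= lee_fin => /ltW.
Qed.

Section induced.
Context (f : X -> X) (cf : continuous f).

Lemma continuous_borel_measurable :
  measurable_fun [set: borel] (f : borel -> borel).
Proof.
apply: (@measurability _ _ borel borel setT f (@open X)) => //.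
move=> _ [B oB <-]; rewrite setTI.
by apply: sub_sigma_algebra; move/continuousP: cf; exact.
Qed.

Definition induced_map (mu : borel_probability) : borel_probability :=
  distribution mu (mfun_Sub (mem_set continuous_borel_measurable)).

Lemma induced_mapE (mu : borel_probability) (A : set borel) :
  induced_map mu A = mu (f @^-1` A).
Proof. by []. Qed.

End induced.
End borel_probability.

(* Main.v *)
(* Move the mass from mu to nu at the constant rate 1/k: at time n take
   (1 - n/k) (f_{n-1} o ... o f_0)_* mu + (n/k) (G_n)_* nu.
   Here G_n = g_n o ... o g_{k-1} o h for n < k and G_k = id, where the g_i are
   set-theoretic right inverses of the f_i. The g_i need not be measurable, so
   h is taken to be a finite-valued measurable map close to the identity; then
   every G_n is measurable. Since f_n o G_n = G_{n+1} up to a small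
   displacement, each step changes the measure by at most 1/k plus a small
   transport. *)
From HB Require Import structures.
Require Import Defs.
From mathcomp Require Import all_boot all_order all_algebra.
From mathcomp Require Import finmap.
From mathcomp Require Import all_classical all_reals all_analysis.
From mathcomp Require Import lra.

Set Implicit Arguments.
Unset Strict Implicit.
Unset Printing Implicit Defensive.

Import Order.TTheory GRing.Theory Num.Theory.
Import numFieldNormedType.Exports.

Local Open Scope classical_set_scope.
Local Open Scope ring_scope.

Section mixture.
Context d (T : measurableType d) (R : realType) (p q : {nonneg R})
  (mu nu : probability T R).

(** The equation on the weights is an argument of the measure, so that the probability instance
    below can be attached to the term itself. *)
Definition mixture of p%:num + q%:num = 1 :=
  measure_add (mscale p mu) (mscale q nu).

Context (pq1 : p%:num + q%:num = 1).

HB.instance Definition _ := Measure.on (mixture pq1).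

Lemma mixtureE (A : set T) :
  mixture pq1 A = (p%:num%:E * mu A + q%:num%:E * nu A)%E.
Proof. by rewrite /mixture measure_addE. Qed.

Let mixture_setT : mixture pq1 setT = 1%E.
Proof. by rewrite mixtureE !probability_setT !mule1 -EFinD pq1. Qed.

HB.instance Definition _ :=
  Measure_isProbability.Build _ _ _ (mixture pq1) mixture_setT.

End mixture.

(** Raising a coefficient by at most [e] costs at most [e * a <= e]. Below, [a] and [a'] are the
    measures of the preimages of a set and of its neighborhood. *)
Lemma ler_mul_error (R : realDomainType) (e s s' a a' : R) : 0 <= e ->
  0 <= s' -> s <= s' + e -> 0 <= a -> a <= 1 -> a <= a' ->
  s * a <= s' * a' + e.
Proof.
move=> e0 s'0 ss' a0 a1 aa'; apply: (le_trans (ler_wpM2r a0 ss')).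
by rewrite mulrDl lerD ?ler_wpM2l// ler_piMr.
Qed.

Section prohorov.
Context (R : realType) (X : pmetricType R).
Implicit Types (A : set X) (P Q mu nu : borel_probability X).

Lemma nbhdP A (e : R) x : nbhd A e x <-> exists2 a, A a & mdist x a < e.
Proof.
split.
  move=> /ereal_inf_lt[_ [a Aa <-]]; rewrite edist_mdist lte_fin.
  by exists a.
move=> [a Aa xa]; rewrite /nbhd/=; apply: (@le_lt_trans _ _ (edist (x, a))).
  by apply: ereal_inf_lbound; exists a.
by rewrite edist_mdist lte_fin.
Qed.

Lemma open_mdist_lt (c : X) (e : R) : open [set x | mdist c x < e].
Proof.
rewrite openE => x /= cx; apply/nbhs_ballP.
exists (e - mdist c x) => /=; first by rewrite subr_gt0.
by move=> y; rewrite ballEmdist/= ltrBrDl; apply/le_lt_trans/metric_triangle.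
Qed.

Lemma open_nbhd A (e : R) : open (nbhd A e).
Proof.
rewrite (_ : nbhd A e = \bigcup_(a in A) [set x | mdist a x < e]).
  by apply: bigcup_open => a _; exact: open_mdist_lt.
apply/seteqP; split => x.
  by move=> /nbhdP[a Aa xa]; exists a; rewrite //= metric_sym.
by move=> [a Aa /= xa]; apply/nbhdP; exists a; rewrite // metric_sym.
Qed.

Lemma measurable_nbhd A (e : R) : measurable (nbhd A e : set (borel X)).
Proof. by apply: sub_sigma_algebra; exact: open_nbhd. Qed.

Lemma prohorov_le P Q (e : R) : 0 < e ->
  (forall A, measurable (A : set (borel X)) ->
    (P A <= Q (nbhd A e) + e%:E)%E /\ (Q A <= P (nbhd A e) + e%:E)%E) ->
  prohorov P Q <= e.
Proof.
move=> e0 H; apply: ge_inf; last by split.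
by exists 0 => x [/ltW].
Qed.

(** The estimate for one step of the path. The displacement from [v] to [v'] is absorbed by the
    neighborhood. In each of the two inequalities only one weight decreases (that of [mu] from [P]
    to [Q], that of [nu] from [Q] to [P]), so the change of weight is paid once and the bound is [e]
    rather than [2 * e]. *)
Lemma prohorov_mixture_le mu nu (u v v' : borel X -> borel X)
    (s t s' t' e : R) P Q :
  0 < e -> 0 <= t -> 0 <= s' -> s' <= s <= s' + e -> t <= t' <= t + e ->
  measurable_fun setT u -> measurable_fun setT v -> measurable_fun setT v' ->
  (forall x, mdist (v x : X) (v' x) < e) ->
  (forall A, measurable (A : set (borel X)) ->
    P A = (s%:E * mu (u @^-1` A) + t%:E * nu (v @^-1` A))%E) ->
  (forall A, measurable (A : set (borel X)) ->
    Q A = (s'%:E * mu (u @^-1` A) + t'%:E * nu (v' @^-1` A))%E) ->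
  prohorov P Q <= e.
Proof.
move=> e0 t0 s'0 /andP[s's ss'] /andP[tt' t't] mfu mv mv' vv' PE QE.
have mpre (w : borel X -> borel X) B : measurable_fun setT w ->
    measurable (B : set (borel X)) -> measurable (w @^-1` B).
  by move=> mw mB; rewrite -[X in measurable X]setTI; exact: mw.
apply: prohorov_le => // A mA; have mAe := measurable_nbhd A e.
rewrite !PE// !QE//.
have uA : (mu (u @^-1` A) <= mu (u @^-1` nbhd A e))%E.
  apply: le_measure; rewrite ?inE; [exact: mpre|exact: mpre|].
  by move=> x Ax; apply/nbhdP; exists (u x) => //; rewrite mdistxx.
have vA : (nu (v @^-1` A) <= nu (v' @^-1` nbhd A e))%E.
  apply: le_measure; rewrite ?inE; [exact: mpre|exact: mpre|].
  by move=> x Ax; apply/nbhdP; exists (v x) => //; rewrite metric_sym.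
have v'A : (nu (v' @^-1` A) <= nu (v @^-1` nbhd A e))%E.
  apply: le_measure; rewrite ?inE; [exact: mpre|exact: mpre|].
  by move=> x Ax; apply/nbhdP; exists (v' x).
have ru1 : (mu (u @^-1` A) <= 1)%E by rewrite probability_le1//; exact: mpre.
have rv1 : (nu (v' @^-1` A) <= 1)%E by rewrite probability_le1//; exact: mpre.
have u0 := fine_ge0 (measure_ge0 mu (u @^-1` A)).
have v'0 := fine_ge0 (measure_ge0 nu (v' @^-1` A)).
have v0 := fine_ge0 (measure_ge0 nu (v @^-1` A)).
have fin (r : borel_probability X) (w : borel X -> borel X) B :
    measurable_fun setT w -> measurable (B : set (borel X)) ->
    r (w @^-1` B) = (fine (r (w @^-1` B)))%:E.
  by move=> mw mB; rewrite fineK// fin_num_measure//; exact: mpre.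
move: uA vA v'A ru1 rv1.
rewrite (fin mu u A)// (fin mu u (nbhd A e))// (fin nu v A)//.
rewrite (fin nu v (nbhd A e))// (fin nu v' A)// (fin nu v' (nbhd A e))//.
rewrite -!EFinM -!EFinD !lee_fin.
move=> uA vA v'A ru1 rv1; split.
- rewrite [leRHS]addrAC lerD//; last exact: ler_pM.
  exact: ler_mul_error (ltW e0) s'0 ss' _ _ _.
- rewrite -addrA lerD//; first by apply: ler_pM => //; exact: le_trans s's.
  exact: ler_mul_error (ltW e0) t0 t't _ _ _.
Qed.

End prohorov.

Section nearest.
Context (R : realType) (X : pmetricType R).

Fixpoint first_close (e : R) (s : seq X) (x : X) : X :=
  if s is c :: s' then if mdist c x < e then c else first_close e s' x
  else point.

(** No regularity of [g] is assumed: each entry [c] of [s] contributes the constant value [g c],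
    selected by membership in an open set. This is what admits arbitrary right inverses. *)
Lemma measurable_comp_first_close (e : R) (s : seq X) (g : X -> X) :
  measurable_fun [set: borel X] (g \o first_close e s : borel X -> borel X).
Proof.
elim: s => [|c s ih] /=; first exact: measurable_cst.
rewrite (_ : _ \o _ = fun x : borel X =>
    if mdist c x < e then g c else (g \o first_close e s) x); last first.
  by apply/funext => x /=; case: ifP.
apply: measurable_fun_ifT => //.
apply: (measurable_fun_bool true); rewrite setTI.
by apply: sub_sigma_algebra; exact: open_mdist_lt.
Qed.

Lemma first_close_lt (e : R) (s : seq X) (x : X) :
  (exists2 c, c \in s & mdist c x < e) -> mdist (first_close e s x) x < e.
Proof.
elim: s => [[c]|c s ih [c' + c'x]]; rewrite ?in_nil//= inE.
case: ifPn => // /negP cx /orP[/eqP c'c|c's]; first by rewrite c'c in c'x.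
by apply: ih; exists c'.
Qed.

Lemma compact_net (e : R) : compact [set: X] -> 0 < e ->
  exists s : seq X, forall x, exists2 c, c \in s & mdist c x < e.
Proof.
rewrite compact_cover => cX e0.
have [|x _|D _ covD] := cX X setT (fun c => (ball c e)^°).
- by move=> c _; exact: open_interior.
- by exists x => //; exact: nbhsx_ballx.
exists (enum_fset D) => x.
have [c cD /interior_subset] := covD x I.
by rewrite ballEmdist; exists c.
Qed.

End nearest.

Section mixing.
Context (R : realType) (X : pmetricType R).

Lemma mixture_path (mu nu : borel_probability X) (k : nat)
    (F G : nat -> borel X -> borel X) :
  (0 < k)%N -> F 0%N = id -> G k = id ->
  (forall n, measurable_fun setT (F n)) ->
  (forall n, measurable_fun setT (G n)) ->
  exists c : nat -> borel_probability X, [/\ c 0%N = mu, c k = nu &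
    forall n, (n <= k)%N -> forall A, measurable A ->
      c n A = ((1 - n%:R / k%:R)%:E * mu (F n @^-1` A) +
               (n%:R / k%:R)%:E * nu (G n @^-1` A))%E].
Proof.
move=> k0 F0 Gk mF mG; have kR : 0 < k%:R :> R by rewrite ltr0n.
(* The bound on [n] sits under the existential so that choice yields a total sequence; beyond [k]
   the first weight is negative and [mu] serves as a placeholder. *)
have mix n : exists P : borel_probability X, (n <= k)%N -> forall A,
    P A = ((1 - n%:R / k%:R)%:E * mu (F n @^-1` A) +
           (n%:R / k%:R)%:E * nu (G n @^-1` A))%E.
  case: (leqP n k) => nk; last by exists mu.
  have q0 : 0 <= n%:R / k%:R :> R by rewrite divr_ge0.
  have p0 : 0 <= 1 - n%:R / k%:R :> R.
    by rewrite subr_ge0 ler_pdivrMr// mul1r ler_nat.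
  have pq1 : (NngNum p0)%:num + (NngNum q0)%:num = 1 by rewrite /= subrK.
  exists (mixture (distribution mu (mfun_Sub (mem_set (mF n))))
    (distribution nu (mfun_Sub (mem_set (mG n)))) pq1).
  by move=> _ A; exact: mixtureE.
have [c cE] := choice mix.
(* The endpoints are overwritten so that they equal [mu] and [nu] as probabilities, not merely set
   by set. The formula persists there: one weight vanishes, and [F 0] and [G k] are the identity. *)
exists (fun n => if n == 0%N then mu else if n == k then nu else c n).
split; rewrite ?eqxx ?[k == 0%N]eqn0Ngt ?k0 // => n nk A mA.
case: eqVneq => [->|n0].
  by rewrite mul0r subr0 mul1e mul0e adde0 F0.
case: eqVneq => [->|nk']; last exact: cE.
by rewrite divff ?gt_eqF// subrr mul0e mul1e add0e Gk.
Qed.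

Fixpoint forward (f : nat -> X -> X) n (x : X) : X :=
  if n is m.+1 then f m (forward f m x) else x.

(** This is [g n \o ... \o g (n + j - 1)]. The outermost map is peeled off first, so that [f n]
    cancels it when [g n] is a right inverse of [f n]. *)
Fixpoint backward (g : nat -> X -> X) n j (x : X) : X :=
  if j is i.+1 then g n (backward g n.+1 i x) else x.

End mixing.

Theorem theorem3p3 (R : realType) (X : pmetricType R) (f : nat -> X -> X)
  (compactX : compact [set: X])
  (contf : forall n : nat, continuous (f n))
  (surjf : forall n : nat, set_surj [set: X] [set: X] (f n)) :
  chain_mixing (@prohorov R X) (fun n => induced_map (contf n)).
Proof.
move=> e e0 mu nu.
(* The estimate for one step gives a non-strict bound, while a chain needs a strict one; hence the
   margin between [d] and [e]. *)
pose d := e / 2; have d0 : 0 < d by rewrite divr_gt0.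
have dlte : d < e by rewrite /d ltr_pdivrMr// ltr_pMr// ltr1n.
have [s sP] := compact_net compactX d0; pose h := first_close d s.
have hd x : mdist (h x) x < d by apply: first_close_lt.
have [g fgK] : exists g, forall n y, f n (g n y) = y.
  have sf n : exists gn, forall y, f n (gn y) = y.
    suff /choice[gn] : forall y, exists x, f n x = y by exists gn.
    by move=> y; have [x _] := surjf n y I; exists x.
  by have [g gK] := choice sf; exists g.
(* [N] exceeds [1 / d], so the rate [1 / k] is at most [d] for every [k >= N]. *)
pose N := (Num.truncn d^-1).+1; exists N; split => // k Nk.
have k0 : (0 < k)%N by exact: leq_trans Nk.
have kR : 0 < k%:R :> R by rewrite ltr0n.
have kd : k%:R^-1 <= d.
  rewrite -[leRHS]invrK lef_pV2 ?posrE ?invr_gt0//.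
  by apply: (le_trans (ltW (truncnS_gt _))); rewrite ler_nat.
pose F : nat -> borel X -> borel X := forward f.
pose G n : borel X -> borel X :=
  if (n < k)%N then backward g n (k - n) \o h else id.
have mf n : measurable_fun setT (f n : borel X -> borel X).
  exact: continuous_borel_measurable.
have mF n : measurable_fun setT (F n).
  by elim: n => [|n ih]; [exact: measurable_id|exact: measurableT_comp (mf n) ih].
have mG n : measurable_fun setT (G n).
  rewrite /G; case: ifP => _; last exact: measurable_id.
  exact: measurable_comp_first_close.
have Gk : G k = id by rewrite /G ltnn.
(* The two points coincide while [n.+1 < k]. Only the last step moves anything: there [f n \o G n]
   is [h] while [G k] is the identity. *)
have fG n x : (n < k)%N -> mdist (f n (G n x)) (G n.+1 x : X) < d.
  move=> nk; rewrite /G nk/= -(subnSK nk)/= fgK.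
  case: ltnP => [_|kn1]; first by rewrite mdistxx.
  by have /eqP -> : (k - n.+1 == 0)%N by []; exact: hd.
have [c [c0 ck cE]] := mixture_path mu nu k0 erefl Gk mF mG.
split => //; exists c; split => // n nk; apply: le_lt_trans dlte.
have step : n.+1%:R / k%:R = n%:R / k%:R + k%:R^-1 :> R.
  by rewrite -natr1 mulrDl mul1r.
have kV0 : 0 < k%:R^-1 :> R by rewrite invr_gt0.
(* Pushing [c n] forward by [f n] turns [F n] into [F n.+1] and [G n] into [f n \o G n], so the [mu]
   parts of the two measures compared differ only in weight. *)
apply: (@prohorov_mixture_le _ _ mu nu (F n.+1) (f n \o G n) (G n.+1)
  (1 - n%:R / k%:R) (n%:R / k%:R) (1 - n.+1%:R / k%:R) (n.+1%:R / k%:R)) => //.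
- by rewrite subr_ge0 ler_pdivrMr// mul1r ler_nat.
- rewrite step; lra.
- rewrite step; lra.
- exact: measurableT_comp (mf n) (mG n).
- by move=> x; exact: fG.
- move=> A mA; rewrite induced_mapE cE// 1?ltnW//.
  by rewrite -[X in measurable X]setTI; exact: mf.
- by move=> A mA; rewrite cE.
Qed.
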